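(* Let $M$ be a nonempty open connected subset of $\mathbb{R}^4$ on which the standard coordinates satisfy $x^1,x^2,x^3,x^4>0$, endowed with the Lorentzian metric $$g = e^{x^1+x^3}(dx^1)^2 + 2\,dx^1dx^2 + (dx^3)^2 + e^{x^1}(dx^4)^2 .$$ Then $(M,g)$ is (i) not locally symmetric but semisymmetric; (ii) not weakly symmetric but weakly Ricci symmetric as well as conformally weakly symmetric; (iii) not recurrent but Ricci recurrent as well as conformally recurrent; (iv) not recurrent but hyper-generalized recurrent; (v) neither of class $\mathcal{A}$ nor of class $\mathcal{B}$, but of constant scalar curvature; (vi) not Einstein but Ricci simple (i.e. special quasi-Einstein); (vii) not recurrent but its curvature 2-forms are recurrent; (viii) does not satisfy $P\cdot P=0$ but satisfies $P\cdot P = L\,Q(S,P)$ for some scalar $L$.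
   Context: Here $n=\dim M=4$, $\nabla$ is the Levi-Civita connection, $\mathscr{R}(X,Y)=[\nabla_X,\nabla_Y]-\nabla_{[X,Y]}$, $R(X_1,X_2,X_3,X_4)=g(\mathscr{R}(X_1,X_2)X_3,X_4)$, $S$ is the Ricci tensor (the trace of $R$ over the first and fourth arguments, $S(X_2,X_3)$), and $r$ is the scalar curvature. All identities are for all vector fields; 1-forms are not required to be nonzero unless stated. The metric convention $2\,dx^1dx^2$ means $g_{12}=g_{21}=1$. Kulkarni-Nomizu product of $(0,2)$-tensors: $(J\wedge F)(X_1,X_2,X_3,X_4)=J(X_1,X_4)F(X_2,X_3)+J(X_2,X_3)F(X_1,X_4)-J(X_1,X_3)F(X_2,X_4)-J(X_2,X_4)F(X_1,X_3)$. Conformal curvature tensor: $C=R-\frac{1}{n-2}(g\wedge S)+\frac{r}{2(n-1)(n-2)}(g\wedge g)$. Projective curvature tensor: $P(X_1,X_2,X_3,X_4)=R(X_1,X_2,X_3,X_4)-\frac{1}{n-1}[g(X_1,X_4)S(X_2,X_3)-g(X_2,X_4)S(X_1,X_3)]$. For a $(0,4)$-tensor $H$ let $\mathcal{H}$ be the $(1,3)$-tensor with $g(\mathcal{H}(X,Y)Z,V)=H(X,Y,Z,V)$. For a symmetric $(0,2)$-tensor $E$ put $(X\wedge_E Y)Z=E(Y,Z)X-E(X,Z)Y$. For a $(0,k)$-tensor $T$: $(H\cdot T)(X_1,\dots,X_k,X,Y)=-\sum_{i=1}^k T(X_1,\dots,\mathcal{H}(X,Y)X_i,\dots,X_k)$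 and $Q(E,T)(X_1,\dots,X_k;X,Y)=-\sum_{i=1}^k T(X_1,\dots,(X\wedge_E Y)X_i,\dots,X_k)$. Definitions. $M$ is: - locally symmetric if $\nabla R=0$; semisymmetric if $R\cdot R=0$; - recurrent (resp. conformally recurrent, Ricci recurrent) if there is a 1-form $A$ with $\nabla T=A\otimes T$ on $\{x\in M: T_x\neq0\}$, where $T=R$ (resp. $T=C$, $T=S$); - weakly symmetric (resp. conformally weakly symmetric) if, with $H=R$ (resp. $H=C$), there are 1-forms $A,B,\overline B,D,\overline D$ on $\{x: H_x\ne 0\}$ such that there $(\nabla_XH)(X_1,X_2,X_3,X_4)=A(X)H(X_1,X_2,X_3,X_4)+B(X_1)H(X,X_2,X_3,X_4)+\overline B(X_2)H(X_1,X,X_3,X_4)+D(X_3)H(X_1,X_2,X,X_4)+\overline D(X_4)H(X_1,X_2,X_3,X)$; - weakly Ricci symmetric if there are 1-forms $A,B,D$ on $\{x:S_x\neq0\}$ such that there $(\nabla_XS)(X_1,X_2)=A(X)S(X_1,X_2)+B(X_1)S(X,X_2)+D(X_2)S(X_1,X)$; - hyper-generalized recurrent if there are 1-forms $A,B$ with $\nabla R=A\otimes R+B\otimes(S\wedge g)$ on $\{x: R_x\neq0,\ (g\wedge S)_x\neq0\}$; - of class $\mathcal{B}$ if $(\nabla_{X_1}S)(X_2,X_3)=(\nabla_{X_2}S)(X_1,X_3)$; of class $\mathcal{A}$ if $(\nabla_{X_1}S)(X_2,X_3)+(\nabla_{X_2}S)(X_3,X_1)+(\nabla_{X_3}S)(X_1,X_2)=0$;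 - Einstein if $S=\frac{r}{n}g$; Ricci simple (special quasi-Einstein) if $S=\beta\,\eta\otimes\eta$ for a scalar function $\beta$ and a 1-form $\eta$. The curvature 2-forms are recurrent if there is a 1-form $A$ such that $(\nabla_{X_1}R)(X_2,X_3,X,Y)+(\nabla_{X_2}R)(X_3,X_1,X,Y)+(\nabla_{X_3}R)(X_1,X_2,X,Y)=A(X_1)R(X_2,X_3,X,Y)+A(X_2)R(X_3,X_1,X,Y)+A(X_3)R(X_1,X_2,X,Y)$. *)

(* Defs.v *)
From HB Require Import structures.
From mathcomp Require Import all_boot all_order all_algebra.
From mathcomp Require Import all_classical all_reals all_analysis.
From mathcomp Require Import ring.

Set Implicit Arguments.
Unset Strict Implicit.
Unset Printing Implicit Defensive.

Import Order.TTheory GRing.Theory Num.Theory.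
Import numFieldNormedType.Exports.

Local Open Scope classical_set_scope.
Local Open Scope ring_scope.

(* The manifold is an open subset M of R^n with its global standard chart.  Every
   tangent space is then identified with 'rV[R]_n, the coordinate field d/dx^i
   being the constant field 'e_i.  Fields are total functions on 'rV[R]_n of
   which only the values near points of M matter: all derivatives below are
   taken at points of the open set M.  A (0,k)-tensor field T is the family of
   k-linear forms T x on the tangent spaces, so an identity between tensor
   fields "for all vector fields" is stated at every point for all tangent
   vectors. *)

Notation "''e_' i" := (delta_mx 0 i)
  (at level 8, i at level 2, format "''e_' i") : ring_scope.

Section Tensors.
Context {R : realType} {n : nat}.

Definition coords := 'rV[R]_n.
Definition vec := 'rV[R]_n.
Definition scalar_field := coords -> R.
Definition vector_field := coords -> vec.
Definition covector_field := coords -> 'cV[R]_n.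
Definition tensor2 := coords -> vec -> vec -> R.
Definition tensor4 := coords -> vec -> vec -> vec -> vec -> R.
Definition tensor6 := coords -> vec -> vec -> vec -> vec -> vec -> vec -> R.
(* the matrix of components g_ij of a metric *)
Definition metric_field := coords -> 'M[R]_n.

(* C^k regularity of a scalar function on an open set U. *)
Fixpoint is_Ck (k : nat) (U : set coords) (f : scalar_field) : Prop :=
  match k with
  | 0%N => forall x, U x -> {for x, continuous f}
  | k'.+1 => forall i : 'I_n,
      (forall x, U x -> derivable f x 'e_i) /\ is_Ck k' U ('D_('e_i) f)
  end.

Definition smooth (U : set coords) (f : scalar_field) : Prop :=
  forall k, is_Ck k U f.

Definition ev (A : covector_field) (x : coords) (u : vec) : R :=
  (u *m A x) 0 0.

Definition one_form (U : set coords) (A : covector_field) : Prop :=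
  forall i, smooth U (fun x => A x i 0).

Section Levi_Civita.
Variable g : metric_field.

Definition inner (x : coords) (u v : vec) : R := (u *m g x *m v^T) 0 0.

(* Gamma^k_ij *)
Definition christoffel (k i j : 'I_n) (x : coords) : R :=
  2^-1 * \sum_(l < n) invmx (g x) k l *
    ('D_('e_i) (fun y => g y j l) x + 'D_('e_j) (fun y => g y i l) x
     - 'D_('e_l) (fun y => g y i j) x).

(* The Levi-Civita connection; see nabla_torsion_free and nabla_metric below. *)
Definition nabla (X Y : vector_field) : vector_field := fun x =>
  'D_(X x) Y x +
  \row_k \sum_(i < n) \sum_(j < n) christoffel k i j x * X x 0 i * Y x 0 j.

Definition bracket (X Y : vector_field) : vector_field := fun x =>
  'D_(X x) Y x - 'D_(Y x) X x.

Definition curvature_operator (X Y Z : vector_field) : vector_field := fun x =>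
  nabla X (nabla Y Z) x - nabla Y (nabla X Z) x - nabla (bracket X Y) Z x.

(* Tangent vectors are extended to vector fields with constant components; by
   tensoriality any other smooth extension gives the same value.  The same
   remark applies to the covariant derivatives D2 and D4. *)
Definition Riem : tensor4 := fun x u v w z =>
  inner x (curvature_operator (cst u) (cst v) (cst w) x) z.

Definition D2 (T : tensor2) (x : coords) (u u1 u2 : vec) : R :=
  'D_u (fun y => T y u1 u2) x
  - T x (nabla (cst u) (cst u1) x) u2
  - T x u1 (nabla (cst u) (cst u2) x).

Definition D4 (T : tensor4) (x : coords) (u u1 u2 u3 u4 : vec) : R :=
  'D_u (fun y => T y u1 u2 u3 u4) x
  - T x (nabla (cst u) (cst u1) x) u2 u3 u4
  - T x u1 (nabla (cst u) (cst u2) x) u3 u4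
  - T x u1 u2 (nabla (cst u) (cst u3) x) u4
  - T x u1 u2 u3 (nabla (cst u) (cst u4) x).

Definition Ric : tensor2 := fun x u v =>
  \sum_(i < n) \sum_(j < n) invmx (g x) i j * Riem x 'e_i u v 'e_j.

Definition scal : scalar_field := fun x =>
  \sum_(i < n) \sum_(j < n) invmx (g x) i j * Ric x 'e_i 'e_j.

Definition KN (J F : tensor2) : tensor4 := fun x u1 u2 u3 u4 =>
  J x u1 u4 * F x u2 u3 + J x u2 u3 * F x u1 u4
  - J x u1 u3 * F x u2 u4 - J x u2 u4 * F x u1 u3.

Definition Conf : tensor4 := fun x u1 u2 u3 u4 =>
  Riem x u1 u2 u3 u4
  - (n%:R - 2)^-1 * KN inner Ric x u1 u2 u3 u4
  + scal x / (2 * (n%:R - 1) * (n%:R - 2)) * KN inner inner x u1 u2 u3 u4.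

Definition Proj : tensor4 := fun x u1 u2 u3 u4 =>
  Riem x u1 u2 u3 u4
  - (n%:R - 1)^-1 * (inner x u1 u4 * Ric x u2 u3 - inner x u2 u4 * Ric x u1 u3).

(* The (1,3)-tensor of H, with its last index raised; see sharpP below. *)
Definition sharp (H : tensor4) (x : coords) (u v w : vec) : vec :=
  (\row_l H x u v w 'e_l) *m invmx (g x).

Definition dot (H T : tensor4) : tensor6 := fun x u1 u2 u3 u4 u v =>
  - (T x (sharp H x u v u1) u2 u3 u4 + T x u1 (sharp H x u v u2) u3 u4
     + T x u1 u2 (sharp H x u v u3) u4 + T x u1 u2 u3 (sharp H x u v u4)).

Definition wedge (E : tensor2) (x : coords) (u v w : vec) : vec :=
  E x v w *: u - E x u w *: v.

Definition Q (E : tensor2) (T : tensor4) : tensor6 := fun x u1 u2 u3 u4 u v =>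
  - (T x (wedge E x u v u1) u2 u3 u4 + T x u1 (wedge E x u v u2) u3 u4
     + T x u1 u2 (wedge E x u v u3) u4 + T x u1 u2 u3 (wedge E x u v u4)).

Definition vanishes2 (T : tensor2) (x : coords) : Prop :=
  forall u1 u2, T x u1 u2 = 0.

Definition vanishes4 (T : tensor4) (x : coords) : Prop :=
  forall u1 u2 u3 u4, T x u1 u2 u3 u4 = 0.

Definition vanishes6 (T : tensor6) (x : coords) : Prop :=
  forall u1 u2 u3 u4 u v, T x u1 u2 u3 u4 u v = 0.

Section Classes.
Variable M : set coords.

Definition locally_symmetric : Prop :=
  forall x, M x -> forall u u1 u2 u3 u4, D4 Riem x u u1 u2 u3 u4 = 0.

Definition semisymmetric : Prop := forall x, M x -> vanishes6 (dot Riem Riem) x.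

Definition recurrent2 (T : tensor2) : Prop :=
  let U := [set x | M x /\ ~ vanishes2 T x] in
  exists2 A, one_form U A &
    forall x, U x -> forall u u1 u2, D2 T x u u1 u2 = ev A x u * T x u1 u2.

Definition recurrent4 (T : tensor4) : Prop :=
  let U := [set x | M x /\ ~ vanishes4 T x] in
  exists2 A, one_form U A &
    forall x, U x -> forall u u1 u2 u3 u4,
      D4 T x u u1 u2 u3 u4 = ev A x u * T x u1 u2 u3 u4.

Definition recurrent : Prop := recurrent4 Riem.
Definition conformally_recurrent : Prop := recurrent4 Conf.
Definition Ricci_recurrent : Prop := recurrent2 Ric.

Definition weakly_symmetric_wrt (H : tensor4) : Prop :=
  let U := [set x | M x /\ ~ vanishes4 H x] in
  exists A B B' D D' : covector_field,
    [/\ one_form U A, one_form U B, one_form U B', one_form U D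
      & one_form U D'] /\
    forall x, U x -> forall u u1 u2 u3 u4,
      D4 H x u u1 u2 u3 u4 =
        ev A x u * H x u1 u2 u3 u4 + ev B x u1 * H x u u2 u3 u4
        + ev B' x u2 * H x u1 u u3 u4 + ev D x u3 * H x u1 u2 u u4
        + ev D' x u4 * H x u1 u2 u3 u.

Definition weakly_symmetric : Prop := weakly_symmetric_wrt Riem.
Definition conformally_weakly_symmetric : Prop := weakly_symmetric_wrt Conf.

Definition weakly_Ricci_symmetric : Prop :=
  let U := [set x | M x /\ ~ vanishes2 Ric x] in
  exists A B D : covector_field,
    [/\ one_form U A, one_form U B & one_form U D] /\
    forall x, U x -> forall u u1 u2,
      D2 Ric x u u1 u2 =
        ev A x u * Ric x u1 u2 + ev B x u1 * Ric x u u2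
        + ev D x u2 * Ric x u1 u.

Definition hyper_generalized_recurrent : Prop :=
  let U := [set x | [/\ M x, ~ vanishes4 Riem x & ~ vanishes4 (KN inner Ric) x]]
  in
  exists A B : covector_field,
    (one_form U A /\ one_form U B) /\
    forall x, U x -> forall u u1 u2 u3 u4,
      D4 Riem x u u1 u2 u3 u4 =
        ev A x u * Riem x u1 u2 u3 u4 + ev B x u * KN Ric inner x u1 u2 u3 u4.

Definition class_A : Prop := forall x, M x -> forall u1 u2 u3,
  D2 Ric x u1 u2 u3 + D2 Ric x u2 u3 u1 + D2 Ric x u3 u1 u2 = 0.

Definition class_B : Prop := forall x, M x -> forall u1 u2 u3,
  D2 Ric x u1 u2 u3 = D2 Ric x u2 u1 u3.

Definition constant_scalar_curvature : Prop :=
  exists c : R, forall x, M x -> scal x = c.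

Definition Einstein : Prop := forall x, M x -> forall u v,
  Ric x u v = scal x / n%:R * inner x u v.

Definition Ricci_simple : Prop :=
  exists (beta : scalar_field) (eta : covector_field),
    [/\ smooth M beta, one_form M eta &
      forall x, M x -> forall u v, Ric x u v = beta x * (ev eta x u * ev eta x v)].

Definition recurrent_curvature_2forms : Prop :=
  exists2 A, one_form M A &
    forall x, M x -> forall u1 u2 u3 u v,
      D4 Riem x u1 u2 u3 u v + D4 Riem x u2 u3 u1 u v + D4 Riem x u3 u1 u2 u v =
      ev A x u1 * Riem x u2 u3 u v + ev A x u2 * Riem x u3 u1 u v
      + ev A x u3 * Riem x u1 u2 u v.

Definition dot_zero (H T : tensor4) : Prop :=
  forall x, M x -> vanishes6 (dot H T) x.

Definition dot_proportional (H T : tensor4) (E : tensor2) : Prop :=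
  exists2 L : scalar_field, smooth M L &
    forall x, M x -> forall u1 u2 u3 u4 u v,
      dot H T x u1 u2 u3 u4 u v = L x * Q E T x u1 u2 u3 u4 u v.

End Classes.

Lemma sharpP (H : tensor4) x u v w z :
  g x \in unitmx ->
  (forall z', H x u v w z' = \sum_(l < n) z' 0 l * H x u v w 'e_l) ->
  inner x (sharp H x u v w) z = H x u v w z.
Proof.
move=> gU Hlin; rewrite /inner /sharp mulmxKV // mxE Hlin.
by apply: eq_bigr => l _; rewrite !mxE mulrC.
Qed.

Lemma christoffelC k i j x :
  (forall y, (g y)^T = g y) -> christoffel k i j x = christoffel k j i x.
Proof.
move=> gT; rewrite /christoffel; congr (_ * _); apply: eq_bigr => l _.
congr (_ * _); rewrite [X in X - _]addrC; congr (_ - 'D_('e_l) _ x).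
by apply/funext => y; rewrite -[in LHS]gT mxE.
Qed.

Lemma nabla_torsion_free X Y x :
  (forall y, (g y)^T = g y) -> nabla X Y x - nabla Y X x = bracket X Y x.
Proof.
move=> gT; rewrite /nabla /bracket opprD addrACA -[RHS]addr0; congr (_ + _).
apply/rowP => k; rewrite !mxE exchange_big /= -sumrB big1 // => j _.
rewrite -sumrB big1 // => i _.
by rewrite [christoffel k j i x]christoffelC // mulrAC subrr.
Qed.

(* nabla g = 0 *)
Lemma nabla_metric x u v w :
  (forall y, (g y)^T = g y) -> g x \in unitmx ->
  (forall i j, differentiable (fun y => g y i j) x) ->
  D2 inner x u v w = 0.
Proof.
move=> gT gU dg.
pose d i j l : R := 'D_('e_i) (fun y => g y j l) x.
have dC i j l : d i j l = d i l j.
  by rewrite /d; congr ('D_('e_i) _ x); apply/funext => y; rewrite -[in LHS]gT mxE.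
have duE j l : 'D_u (fun y => g y j l) x = \sum_(i < n) u 0 i * d i j l.
  rewrite deriveE // {1}(row_sum_delta u) linear_sum /=; apply: eq_bigr => i _.
  by rewrite linearZ /= /d deriveE.
have innerE y a b : inner y a b = \sum_(j < n) \sum_(l < n) a 0 j * b 0 l * g y j l.
  rewrite /inner mxE exchange_big /=; apply: eq_bigr => l _.
  rewrite !mxE mulr_suml; apply: eq_bigr => j _.
  by rewrite mulrAC.
have GE i j l : \sum_(k < n) christoffel k i j x * g x k l
    = 2^-1 * (d i j l + d j i l - d l i j).
  pose c m := d i j m + d j i m - d m i j.
  transitivity (2^-1 * ((\row_m c m) *m invmx (g x) *m g x) 0 l); last first.
    by rewrite mulmxKV // mxE.
  rewrite mxE mulr_sumr; apply: eq_bigr => k _.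
  rewrite mulrA /christoffel; congr (_ * _ * _).
  rewrite mxE; apply: eq_bigr => m _.
  have -> : invmx (g x) k m = invmx (g x) m k.
    by rewrite -[in RHS](gT x) -trmx_inv mxE.
  by rewrite mulrC !mxE.
have nE a : nabla (cst u) (cst a) x =
    \row_k \sum_(i < n) \sum_(j < n) christoffel k i j x * u 0 i * a 0 j.
  by rewrite /nabla derive_cst add0r.
have half a b : inner x (nabla (cst u) (cst a) x) b =
   \sum_(j < n) \sum_(l < n) \sum_(i < n) a 0 j * b 0 l * u 0 i *
       (2^-1 * (d i j l + d j i l - d l i j)).
  rewrite innerE nE [LHS]exchange_big [RHS]exchange_big; apply: eq_bigr => l _.
  under eq_bigr => k _.
    rewrite mxE !mulr_suml.
    under eq_bigr do rewrite !mulr_suml.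
    rewrite exchange_big.
    over.
  rewrite exchange_big; apply: eq_bigr => j _.
  rewrite exchange_big; apply: eq_bigr => i _.
  rewrite -GE mulr_sumr; apply: eq_bigr => k _.
  by rewrite mulrACA mulrA; ring.
have innerC a b : inner x a b = inner x b a.
  rewrite !innerE exchange_big; apply: eq_bigr => j _; apply: eq_bigr => l _.
  by rewrite [a 0 l * _]mulrC -[in LHS]gT mxE.
rewrite /D2 [inner x v _]innerC !half.
have -> : 'D_u (fun y => inner y v w) x =
    \sum_(j < n) \sum_(l < n) \sum_(i < n) v 0 j * w 0 l * u 0 i * d i j l.
  have -> : (fun y => inner y v w) =
      \sum_(j < n) \sum_(l < n) (v 0 j * w 0 l) \*o (fun y => g y j l).
    apply/funext => y; rewrite innerE fct_sumE; apply: eq_bigr => j _.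
    by rewrite fct_sumE.
  have dgu j l : derivable (fun y => g y j l) x u by exact: diff_derivable.
  have dZ j l : derivable ((v 0 j * w 0 l) \*o (fun y => g y j l)) x u.
    exact: derivableZ.
  rewrite derive_sum; last by move=> j; apply: derivable_sum => l.
  apply: eq_bigr => j _; rewrite derive_sum //; apply: eq_bigr => l _.
  rewrite deriveMl // duE mulr_sumr; apply: eq_bigr => i _.
  by rewrite mulrA.
rewrite [X in _ - X]exchange_big -!sumrB big1 // => j _.
rewrite -!sumrB big1 // => l _; rewrite -!sumrB big1 // => i _.
rewrite (dC i l j) (dC l i j) (dC l j i) (dC j i l).
by field.
Qed.

End Levi_Civita.
End Tensors.

(* Coordinates are numbered from 0: x^1, x^2, x^3, x^4 are x 0 0, ..., x 0 3. *)
Definition metric (R : realType) : metric_field (R := R) (n := 4) := fun x =>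
  expR (x 0 0 + x 0 2) *: delta_mx 0 0 + (delta_mx 0 1 + delta_mx 1 0)
  + delta_mx 2 2 + expR (x 0 0) *: delta_mx 3 3.

Arguments metric : clear implicits.

Lemma metric_sym (R : realType) (x : 'rV[R]_4) : (metric R x)^T = metric R x.
Proof.
rewrite /metric /= !raddfD /= !linearZ /= !trmx_delta.
by rewrite [delta_mx 1 0 + _]addrC.
Qed.

Lemma metric_Lorentzian (R : realType) (x : 'rV[R]_4) : exists2 P : 'M[R]_4,
  P \in unitmx &
  P *m metric R x *m P^T = diag_mx (\row_i (if i == 0 then -1 else 1)).
Proof.
pose E := expR (x 0 0 + x 0 2); pose s := expR (- x 0 0 / 2).
have sE : s * expR (x 0 0) * s = 1.
  by rewrite mulrAC /s -!expRD -[RHS]expR0; congr expR; field.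
pose rows := [:: [:: 1; (- 1 - E) / 2; 0; 0]; [:: 1; (1 - E) / 2; 0; 0];
                 [:: 0; 0; 1; 0]; [:: 0; 0; 0; s]] : seq (seq R).
pose P : 'M[R]_4 := \matrix_(i, j) nth 0 (nth [::] rows i) j.
have PE : P *m metric R x *m P^T =
    diag_mx (\row_i (if i == 0 then -1 else 1)).
  apply/matrixP => i j.
  have entry k l : metric R x k l = nth 0 (nth [::]
      [:: [:: E; 1; 0; 0]; [:: 1; 0; 0; 0]; [:: 0; 0; 1; 0];
          [:: 0; 0; 0; expR (x 0 0)]] k) l.
    rewrite /metric !mxE -/E.
    case: k l => [[|[|[|[|//]]]] /= ?] [[|[|[|[|//]]]] /= ?];
    by rewrite ?mulr0 ?mulr1 ?addr0 ?add0r.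
  rewrite !mxE; under eq_bigr do rewrite !mxE.
  under eq_bigr do under eq_bigr do rewrite mxE entry.
  rewrite !big_ord_recl !big_ord0 /=.
  case: i j => [[|[|[|[|//]]]] /= ?] [[|[|[|[|//]]]] /= ?];
  rewrite /= ?mulr1n ?mulr0n; try by field.
  by rewrite !(mul0r, mulr0, add0r, addr0).
exists P => //.
suff : P *m metric R x *m P^T \in unitmx by rewrite !unitmx_mul -andbA => /andP[].
rewrite PE unitmxE det_diag unitfE; apply/prodf_neq0 => i _; rewrite mxE.
by case: ifP; rewrite ?oppr_eq0 oner_eq0.
Qed.

(* Main.v *)
Require Import Defs.
From mathcomp Require Import all_boot all_order all_algebra.
From mathcomp Require Import all_classical all_reals all_analysis.
From mathcomp Require Import ring lra.
Import Order.TTheory GRing.Theory Num.Theory.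
Import numFieldNormedType.Exports.
Local Open Scope classical_set_scope.
Local Open Scope ring_scope.

(** The metric is a pp-wave: the null 1-form [dx^1] is parallel.  Write
    [E = exp (x^1 + x^3)], [F = exp x^1], [Z = dx^1 /\ dx^3] and
    [W = dx^1 /\ dx^4].  (The comments number vectors and components from 1 to
    4, the code from 0 to 3.)  Everything follows from the closed forms
      [R = E/2 Z (x) Z + F/4 W (x) W],  [S = - (E/2 + 1/4) dx^1 (x) dx^1],
      [r = 0],  [C = (E/4 - 1/8) (Z (x) Z - F W (x) W)]
    (lemmas [RiemE], [RicE], [scalE] and [ConfE]).

    The tensors [dx^1], [Z (x) Z] and [F W (x) W] are parallel, so a covariant
    derivative only differentiates the coefficients, and [d ln E = dx^1 + dx^3].
    Hence [S] and [C], which have a single coefficient, are recurrent; taking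
    zero for the other 1-forms, they satisfy the weak symmetry conditions too.
    In [nabla R] the component along [W (x) W] is zero although that of [R] is
    not: this rules out weak symmetry, hence recurrence.  Since
    [g /\ S] is a multiple of [Z (x) Z + F W (x) W], a second 1-form can
    absorb that component, which is hyper-generalized recurrence.  The
    denominators [2 E + 1] and [2 E - 1] in the recurrence forms do not vanish
    because [E > 1] where the coordinates are positive.

    The endomorphisms [R(u, v)] are skew, and take values in the kernel of
    [dx^1], so they annihilate [g] and [S].  They also annihilate [Z] and [W],
    because the components of [R(u, v) w] along [e_3] and [e_4] are
    proportional to [dx^1 (w)]; hence they annihilate [R] and [P].  As the
    endomorphism of [P] is that of [R] minus a third of that of [S], it follows
    that [P.P = - Q(S, P) / 3] ([dot_Proj_Proj]), and one component shows that
    this is not zero. *)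

Lemma big_ord4 (V : nmodType) (f : 'I_4 -> V) :
  \sum_(i < 4) f i = f 0 + f 1 + f 2 + f 3.
Proof.
rewrite !big_ord_recl big_ord0 addr0 !addrA.
by congr (f _ + f _ + f _ + f _); apply: val_inj.
Qed.

Set Implicit Arguments.
Unset Strict Implicit.

Section WaveMetric.
Variable R : realType.
Local Notation V := 'rV[R]_4.
Local Notation g := (metric R).
Implicit Types (x u v w z : V) (i j k : 'I_4).

(** * Coordinates and the two exponential coefficients *)

Definition vec4 (a b c d : R) : V := \row_k [:: a; b; c; d]`_k.

Lemma vec4E a b c d :
  (vec4 a b c d 0 0 = a) * (vec4 a b c d 0 1 = b) * (vec4 a b c d 0 2 = c)
  * (vec4 a b c d 0 3 = d).
Proof. by rewrite !mxE. Qed.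

Lemma vec4P u v : u 0 0 = v 0 0 -> u 0 1 = v 0 1 -> u 0 2 = v 0 2 ->
  u 0 3 = v 0 3 -> u = v.
Proof.
move=> e0 e1 e2 e3; apply/rowP => -[[|[|[|[|//]]]] lti].
- by rewrite (_ : Ordinal lti = 0) //; apply: val_inj.
- by rewrite (_ : Ordinal lti = 1) //; apply: val_inj.
- by rewrite (_ : Ordinal lti = 2) //; apply: val_inj.
- by rewrite (_ : Ordinal lti = 3) //; apply: val_inj.
Qed.

(** The two coefficients of the metric: [g_11 = E] and [g_44 = F]. *)
Definition E x : R := expR (x 0 0 + x 0 2).
Definition F x : R := expR (x 0 0).

Lemma E_gt0 x : 0 < E x. Proof. exact: expR_gt0. Qed.
Lemma F_neq0 x : F x != 0. Proof. by rewrite gt_eqF // expR_gt0. Qed.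

Lemma is_derive_coord x u i : is_derive x u (fun y : V => y 0 i) (u 0 i).
Proof.
apply: DeriveDef.
  exact/diff_derivable/differentiable_coord.
rewrite /derive; apply: cvg_lim => //=.
apply: cvg_near_cst; near=> h.
rewrite !mxE addrK scalerA mulVf ?scale1r //.
by near: h; exact: nbhs_dnbhs_neq.
Unshelve. all: by end_near. Qed.

Lemma is_derive_exp (f : V -> R) x u df : differentiable f x ->
  is_derive x u f df -> is_derive x u (expR \o f) (expR (f x) * df).
Proof.
move=> dfx [_ <-].
have dexp : differentiable expR (f x) by exact/derivable1_diffP/derivable_expR.
have dc : differentiable (expR \o f) x by exact: differentiable_comp.
apply: DeriveDef; first exact: diff_derivable.
rewrite !deriveE // diff_comp //= diff1E // derive1E.
have -> : 'D_1 expR (f x) = expR (f x) by rewrite derive_val.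
by rewrite mulrC.
Qed.

Lemma differentiable_E x : differentiable E x.
Proof.
apply: (@differentiable_comp _ _ _ _
  ((fun y : V => y 0 0) + (fun y : V => y 0 2)) expR).
  by apply: differentiableD; exact: differentiable_coord.
exact/derivable1_diffP/derivable_expR.
Qed.

Lemma is_derive_E x u : is_derive x u E (E x * (u 0 0 + u 0 2)).
Proof.
apply: (@is_derive_exp ((fun y : V => y 0 0) + (fun y : V => y 0 2))).
  by apply: differentiableD; exact: differentiable_coord.
by apply: is_deriveD; exact: is_derive_coord.
Qed.

Lemma is_derive_F x u : is_derive x u F (F x * u 0 0).
Proof.
apply: (@is_derive_exp (fun y : V => y 0 0)); first exact: differentiable_coord.
exact: is_derive_coord.
Qed.

(** Every tensor component whose derivative occurs below is affine in [E] and
    [F], or a product of two such functions. *)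
Lemma is_derive_EF (a b c : R) x u :
  is_derive x u (fun y => a * E y + b * F y + c)
    (a * (E x * (u 0 0 + u 0 2)) + b * (F x * u 0 0)).
Proof.
have dE := is_derive_E x u; have dF := is_derive_F x u.
by rewrite -[X in is_derive _ _ _ X]addr0; apply: is_deriveD.
Qed.

Lemma derive_EF (a b c : R) x u :
  'D_u (fun y => a * E y + b * F y + c) x =
  a * (E x * (u 0 0 + u 0 2)) + b * (F x * u 0 0).
Proof. by have [] := is_derive_EF a b c x u. Qed.

(** * The Levi-Civita connection *)

Lemma metricE x i j : g x i j =
  nth 0 (nth [::] [:: [:: E x; 1; 0; 0]; [:: 1; 0; 0; 0]; [:: 0; 0; 1; 0];
                      [:: 0; 0; 0; F x]] i) j.
Proof.
rewrite /metric !mxE -/(E x) -/(F x).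
by case: i j => [[|[|[|[|//]]]] /= ?] [[|[|[|[|//]]]] /= ?];
   rewrite ?mulr0 ?mulr1 ?addr0 ?add0r.
Qed.

Definition cometric x : 'M[R]_4 := \matrix_(i, j)
  nth 0 (nth [::] [:: [:: 0; 1; 0; 0]; [:: 1; - E x; 0; 0]; [:: 0; 0; 1; 0];
                      [:: 0; 0; 0; (F x)^-1]] i) j.

Lemma invmx_metric x : invmx (g x) = cometric x.
Proof.
have gK : g x *m cometric x = 1%:M.
  apply/matrixP => i j; rewrite mxE big_ord4 !metricE !mxE.
  have FK := mulfV (F_neq0 x).
  case: i j => [[|[|[|[|//]]]] /= ?] [[|[|[|[|//]]]] /= ?];
  rewrite ?FK ?mulr1n ?mulr0n; by ring.
have [gU _] := mulmx1_unit gK.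
by rewrite -[LHS]mulmx1 -gK mulKmx.
Qed.

Lemma innerE x u v : inner g x u v =
  E x * u 0 0 * v 0 0 + u 0 0 * v 0 1 + u 0 1 * v 0 0 + u 0 2 * v 0 2
  + F x * u 0 3 * v 0 3.
Proof. by rewrite /inner !mxE big_ord4 !mxE !big_ord4 !metricE /=; ring. Qed.

(** The bilinear form of the Christoffel symbols: the nonzero ones are
    [Gamma^2_11 = Gamma^2_13 = E/2], [Gamma^2_44 = - F/2], [Gamma^3_11 = - E/2]
    and [Gamma^4_14 = 1/2].  Its first component vanishes, which says that
    [dx^1] is parallel. *)
Definition Gamma x u v : V := vec4 0
  (E x / 2 * (u 0 0 * v 0 0 + u 0 0 * v 0 2 + u 0 2 * v 0 0)
   - F x / 2 * (u 0 3 * v 0 3))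
  (- (E x / 2 * (u 0 0 * v 0 0)))
  ((u 0 0 * v 0 3 + u 0 3 * v 0 0) / 2).

Lemma derive_metric x i j l : 'D_('e_i) (fun y => g y j l) x =
  E x * ((i == 0)%:R + (i == 2)%:R) * (j == 0)%:R * (l == 0)%:R
  + F x * (i == 0)%:R * (j == 3)%:R * (l == 3)%:R.
Proof.
pose a : R := (j == 0)%:R * (l == 0)%:R.
pose b : R := (j == 3)%:R * (l == 3)%:R.
pose c : R := (j == 0)%:R * (l == 1)%:R + (j == 1)%:R * (l == 0)%:R
  + (j == 2)%:R * (l == 2)%:R.
have -> : (fun y => g y j l) = (fun y => a * E y + b * F y + c).
  apply/funext => y; rewrite metricE /a /b /c.
  by case: j l {a b c} => [[|[|[|[|//]]]] /= ?] [[|[|[|[|//]]]] /= ?] /=; ring.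
by rewrite derive_EF !mxE /= ![_ == i]eq_sym /a /b; ring.
Qed.

(** The Kronecker deltas are kept as unevaluated scalars in [i] and [j], so that
    only the four values of [k] have to be distinguished. *)
Lemma christoffelE k i j x : christoffel g k i j x =
  (k == 1)%:R * (E x / 2 * ((i == 0)%:R * (j == 0)%:R
      + (i == 0)%:R * (j == 2)%:R + (i == 2)%:R * (j == 0)%:R)
    - F x / 2 * ((i == 3)%:R * (j == 3)%:R))
  - (k == 2)%:R * (E x / 2 * ((i == 0)%:R * (j == 0)%:R))
  + (k == 3)%:R * (((i == 0)%:R * (j == 3)%:R + (i == 3)%:R * (j == 0)%:R) / 2).
Proof.
rewrite /christoffel invmx_metric big_ord4 !derive_metric !mxE /=.
have F0 := F_neq0 x.
move: (i == 0)%:R (i == 2)%:R (i == 3)%:R (j == 0)%:R (j == 2)%:R (j == 3)%:R.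
case: k => [[|[|[|[|//]]]] /= ?] i0 i2 i3 j0 j2 j3; by field.
Qed.

Lemma nablaE x u (Y : vector_field) :
  nabla g (cst u) Y x = 'D_u Y x + Gamma x u (Y x).
Proof.
rewrite /nabla; congr (_ + _); set v := Y x.
apply: vec4P; rewrite vec4E mxE.
- rewrite big1 // => i _; rewrite big1 // => j _.
  by rewrite christoffelE /=; ring.
all: rewrite big_ord4 !big_ord4 !christoffelE /= /cst; ring.
Qed.

Lemma derive_vec_EF (a b c : V) x u :
  'D_u (fun y => E y *: a + F y *: b + c) x =
  (E x * (u 0 0 + u 0 2)) *: a + (F x * u 0 0) *: b.
Proof.
have entryE (i : 'I_1) j : (fun y => (E y *: a + F y *: b + c) i j) =
    (fun y => a i j * E y + b i j * F y + c i j).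
  by apply/funext => y; rewrite !mxE; ring.
rewrite derive_mx; last first.
  apply/derivable_mxP => i j; rewrite entryE.
  by case: (is_derive_EF (a i j) (b i j) (c i j) x u).
by apply/matrixP => i j; rewrite mxE entryE derive_EF !mxE; ring.
Qed.

Lemma derive_Gamma x u v w : 'D_u (fun y => Gamma y v w) x =
  vec4 0
   (E x * (u 0 0 + u 0 2) / 2 *
      (v 0 0 * w 0 0 + v 0 0 * w 0 2 + v 0 2 * w 0 0)
    - F x * u 0 0 / 2 * (v 0 3 * w 0 3))
   (- (E x * (u 0 0 + u 0 2) / 2 * (v 0 0 * w 0 0))) 0.
Proof.
have Gamma_EF : (fun y => Gamma y v w) = (fun y =>
    E y *: vec4 0 ((v 0 0 * w 0 0 + v 0 0 * w 0 2 + v 0 2 * w 0 0) / 2)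
                  (- (v 0 0 * w 0 0 / 2)) 0
    + F y *: vec4 0 (- (v 0 3 * w 0 3 / 2)) 0 0
    + vec4 0 0 0 ((v 0 0 * w 0 3 + v 0 3 * w 0 0) / 2)).
  by apply/funext => y; apply: vec4P; rewrite /Gamma !mxE /=; ring.
by rewrite Gamma_EF derive_vec_EF; apply: vec4P; rewrite !mxE /=; ring.
Qed.

(** * The curvature tensors and their covariant derivatives *)

Lemma nabla_cst u v : nabla g (cst u) (cst v) = fun x => Gamma x u v.
Proof. by apply/funext => x; rewrite nablaE derive_cst add0r. Qed.

Lemma bracket_cst u v : bracket (cst u) (cst v) = cst 0 :> vector_field.
Proof. by apply/funext => x; rewrite /bracket !derive_cst subrr. Qed.

(** The 2-forms [dx^1 /\ dx^3] and [dx^1 /\ dx^4]. *)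
Definition Z u v : R := u 0 0 * v 0 2 - u 0 2 * v 0 0.
Definition W u v : R := u 0 0 * v 0 3 - u 0 3 * v 0 0.

(** As for every pp-wave, the curvature is quadratic in 2-forms divisible by the
    parallel null 1-form [dx^1]. *)
Lemma RiemE x u v w z :
  Riem g x u v w z = E x / 2 * (Z u v * Z w z) + F x / 4 * (W u v * W w z).
Proof.
rewrite /Riem /curvature_operator bracket_cst !nabla_cst !nablaE !derive_Gamma.
rewrite innerE /Gamma !mxE /= /Z /W; by field.
Qed.

Definition Ricci_coef x : R := E x / 2 + 4^-1.

Lemma Ricci_coef_gt0 x : 0 < Ricci_coef x.
Proof. by have := E_gt0 x; rewrite /Ricci_coef; lra. Qed.

Lemma metric_traceE x (f : 'I_4 -> 'I_4 -> R) :
  \sum_(i < 4) \sum_(j < 4) invmx (g x) i j * f i j =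
  f 0 1 + f 1 0 - E x * f 1 1 + f 2 2 + (F x)^-1 * f 3 3.
Proof. by rewrite invmx_metric big_ord4 !big_ord4 !mxE /=; ring. Qed.

Lemma RicE x u v : Ric g x u v = - Ricci_coef x * (u 0 0 * v 0 0).
Proof.
rewrite /Ric metric_traceE !RiemE /Z /W !mxE /= /Ricci_coef.
by field; exact: F_neq0.
Qed.

(** [Ric] is a multiple of [dx^1 (x) dx^1] and [dx^1] is null, so the trace
    vanishes. *)
Lemma scalE x : scal g x = 0.
Proof. by rewrite /scal metric_traceE !RicE !mxE /=; ring. Qed.

(** Only the restriction of [g] to the directions 3 and 4 survives the product
    with [dx^1 (x) dx^1]: the terms of [g] divisible by [dx^1] cancel out. *)
Lemma KN_RicE x u v w z :
  KN (inner g) (Ric g) x u v w z =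
  Ricci_coef x * (Z u v * Z w z + F x * (W u v * W w z)).
Proof. by rewrite /KN !innerE !RicE /Z /W; ring. Qed.

Lemma KNC (J J' : tensor2) x u v w z : KN J J' x u v w z = KN J' J x u v w z.
Proof. by rewrite /KN; ring. Qed.

Lemma ConfE x u v w z : Conf g x u v w z =
  (E x / 4 - 8^-1) * (Z u v * Z w z - F x * (W u v * W w z)).
Proof. by rewrite /Conf scalE RiemE KN_RicE /Ricci_coef; field. Qed.

Lemma ProjE x u v w z : Proj g x u v w z =
  Riem g x u v w z
  - 3^-1 * (inner g x u z * Ric g x v w - inner g x v z * Ric g x u w).
Proof. by rewrite /Proj; congr (_ - _^-1 * _); ring. Qed.

(** Since [dx^1] is parallel, only the coefficient of [Ric] is
    differentiated. *)
Lemma D2_RicE x u v w : D2 g (Ric g) x u v w =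
  - (E x / 2 * (u 0 0 + u 0 2)) * (v 0 0 * w 0 0).
Proof.
have -> : D2 g (Ric g) x u v w = 'D_u (fun y => Ric g y v w) x.
  by rewrite /D2 !nabla_cst !RicE /Gamma !mxE /=; ring.
have -> : (fun y => Ric g y v w) = (fun y =>
    (- (v 0 0 * w 0 0) / 2) * E y + 0 * F y + (- (v 0 0 * w 0 0) / 4)).
  by apply/funext => y; rewrite RicE /Ricci_coef; field.
by rewrite derive_EF; field.
Qed.

(** The tensors [Z (x) Z] and [F *: W (x) W] are parallel: [nabla dx^3] and
    the part of [nabla dx^4] not proportional to [dx^4] are multiples of
    [dx^1], and the factor [-1/2 dx^1] left in [nabla dx^4] is compensated by
    [dF = F dx^1].  So only the coefficient [E/2] contributes. *)
Lemma D4_RiemE x u u1 u2 u3 u4 : D4 g (Riem g) x u u1 u2 u3 u4 =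
  E x / 2 * (u 0 0 + u 0 2) * (Z u1 u2 * Z u3 u4).
Proof.
rewrite /D4 !nabla_cst.
have -> : (fun y => Riem g y u1 u2 u3 u4) = (fun y =>
    (Z u1 u2 * Z u3 u4 / 2) * E y + (W u1 u2 * W u3 u4 / 4) * F y + 0).
  by apply/funext => y; rewrite RiemE; field.
by rewrite derive_EF !RiemE /Gamma /Z /W !mxE /=; field.
Qed.

(** Again only the coefficient of a parallel tensor is differentiated, so [C]
    is recurrent. *)
Lemma D4_ConfE x u u1 u2 u3 u4 : D4 g (Conf g) x u u1 u2 u3 u4 =
  E x / 4 * (u 0 0 + u 0 2) * (Z u1 u2 * Z u3 u4 - F x * (W u1 u2 * W u3 u4)).
Proof.
rewrite /D4 !nabla_cst.
pose s y := (4^-1 * E y + 0 * F y + - 8^-1).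
pose t y := (0 * E y + (- (W u1 u2 * W u3 u4)) * F y + Z u1 u2 * Z u3 u4).
have -> : (fun y => Conf g y u1 u2 u3 u4) = s * t.
  by apply/funext => y; rewrite ConfE mulrfctE /s /t; field.
rewrite deriveM;
  [|exact: (@ex_derive _ _ _ _ _ _ _ (is_derive_EF _ _ _ x u))..].
rewrite !derive_EF !ConfE /s /t /GRing.scale /= /Gamma /Z /W !mxE /=; by field.
Qed.

(** * Smoothness of rational functions of E *)

Section Smoothness.
Variable U : set V.

(** Smoothness asks for partial derivatives of all orders.  Instead of deriving
    closure properties of each class C^k, one proves smoothness for a family
    that partial differentiation maps to itself: the rational functions of [E]
    without pole on [U]. *)
Inductive E_rational : (V -> R) -> Prop :=
| E_rational_cst c : E_rational (cst c)
| E_rational_E : E_rational E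
| E_rational_add f1 f2 : E_rational f1 -> E_rational f2 -> E_rational (f1 + f2)
| E_rational_mul f1 f2 : E_rational f1 -> E_rational f2 -> E_rational (f1 * f2)
| E_rational_inv f : (forall x, U x -> f x != 0) -> E_rational f ->
    E_rational (fun x => (f x)^-1).

Lemma E_rational_differentiable f x : E_rational f -> U x -> differentiable f x.
Proof.
move=> rf Ux.
elim: f / rf => [c||f1 f2 _ df1 _ df2|f1 f2 _ df1 _ df2|f f0 _ df].
- exact: differentiable_cst.
- exact: differentiable_E.
- exact: differentiableD.
- exact: differentiableM.
- by apply: differentiableV => //; exact: f0.
Qed.

Lemma E_rational_derive f i : E_rational f ->
  exists2 f', E_rational f' & forall x, U x -> 'D_('e_i) f x = f' x.
Proof.
move=> rf.
have dd f1 x : E_rational f1 -> U x -> derivable f1 x 'e_i.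
  by move=> rf1 Ux; apply: diff_derivable; exact: E_rational_differentiable.
elim: f / rf => [c||f1 f2 r1 [d1 rd1 E1] r2 [d2 rd2 E2]
                   |f1 f2 r1 [d1 rd1 E1] r2 [d2 rd2 E2]|f f0 rf [d rd dE]].
- by exists (cst 0) => [|x _]; [exact: E_rational_cst | exact: derive_cst].
- exists (E * cst ((i == 0)%:R + (i == 2)%:R)) => [|x _].
    by apply: E_rational_mul; [exact: E_rational_E | exact: E_rational_cst].
  have [_ ->] := is_derive_E x 'e_i.
  by rewrite !mxE /= ![_ == i]eq_sym.
- exists (d1 + d2) => [|x Ux]; first exact: E_rational_add.
  by rewrite deriveD ?E1 ?E2 //; exact: dd.
- exists (f1 * d2 + f2 * d1) => [|x Ux].
    by apply: E_rational_add; exact: E_rational_mul.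
  by rewrite deriveM ?E1 ?E2 //; exact: dd.
- pose q x := (f x)^-1; exists (cst (-1) * (q * q) * d) => [|x Ux].
    have rq : E_rational q by exact: E_rational_inv.
    apply: E_rational_mul => //.
    by apply: E_rational_mul; [exact: E_rational_cst | exact: E_rational_mul].
  rewrite deriveV ?f0 //; last exact: dd.
  by rewrite dE // /q !mulrfctE /GRing.scale /= -exprVn expr2 mulN1r.
Qed.

Hypothesis U_open : open U.

(** On [U] a partial derivative is only known to coincide with a member of the
    family, hence the induction over all functions that agree on [U] with a
    member; openness of [U] makes this agreement hold near each point. *)
Lemma E_rational_smooth f : E_rational f -> smooth U f.
Proof.
move=> rf k.
suff: forall f', (forall x, U x -> f' x = f x) -> is_Ck k U f' by apply.
elim: k f rf => [|k IHk] f rf f' f'E.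
  all: have near_f x (Ux : U x) : \near x, f x = f' x
    by apply: filterS (open_nbhs_nbhs (conj U_open Ux)) => y /f'E.
  move=> x Ux; rewrite /prop_for /continuous_at f'E //.
  apply: cvg_trans (near_eq_cvg (near_f x Ux)) _.
  exact: (differentiable_continuous (E_rational_differentiable rf Ux)).
move=> i; split=> [x Ux|].
  apply: near_eq_derivable (near_f x Ux) _.
  by apply: diff_derivable; exact: E_rational_differentiable rf Ux.
have [d rd dE] := E_rational_derive i rf.
apply: IHk rd _ _ => x Ux; rewrite -dE //; symmetry.
exact: near_eq_derive (near_f x Ux).
Qed.

End Smoothness.

Lemma is_Ck_sub (k : nat) (U U' : set V) f :
  U `<=` U' -> is_Ck k U' f -> is_Ck k U f.
Proof.
move=> sU; elim: k f => [|k IHk] f Cf; first by move=> x /sU; exact: Cf.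
by move=> i; have [df Cdf] := Cf i; split=> [x /sU|]; [exact: df | exact: IHk].
Qed.

Definition scaled_form (f : V -> R) (a : 'cV[R]_4) : covector_field :=
  fun x => f x *: a.

(** The 1-form [d (ln E) = dx^1 + dx^3]. *)
Definition dlogE : 'cV[R]_4 := \col_i [:: 1; 0; 1; 0]`_i.

Lemma ev_dx0 f x u : ev (scaled_form f (delta_mx 0 0)) x u = f x * u 0 0.
Proof. by rewrite /ev /scaled_form mxE big_ord4 !mxE /=; ring. Qed.

Lemma ev_dlogE f x u : ev (scaled_form f dlogE) x u = f x * (u 0 0 + u 0 2).
Proof. by rewrite /ev /scaled_form mxE big_ord4 !mxE /=; ring. Qed.

(** * The derivations R.R, R.P and P.P *)

Lemma sharpE H x u v w : sharp g H x u v w =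
  vec4 (H x u v w 'e_1) (H x u v w 'e_0 - E x * H x u v w 'e_1)
       (H x u v w 'e_2) ((F x)^-1 * H x u v w 'e_3).
Proof.
rewrite /sharp invmx_metric.
by apply: vec4P; rewrite vec4E mxE big_ord4 !mxE /=; ring.
Qed.

(** The endomorphism [R(u, v)] is nilpotent: it sends [e_1] to the span of
    [e_3] and [e_4], these to multiples of [e_2], and [e_2] to zero. *)
Lemma sharp_RiemE x u v w : sharp g (Riem g) x u v w =
  vec4 0 (- (E x / 2 * Z u v * w 0 2 + F x / 4 * W u v * w 0 3))
    (E x / 2 * Z u v * w 0 0) (W u v * w 0 0 / 4).
Proof.
rewrite sharpE !RiemE; have F0 := F_neq0 x.
by apply: vec4P; rewrite !vec4E /Z /W !mxE /=; field.
Qed.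

Lemma sharp_ProjE x u v w : sharp g (Proj g) x u v w =
  sharp g (Riem g) x u v w - 3^-1 *: wedge (Ric g) x u v w.
Proof.
rewrite !sharpE !ProjE /wedge !innerE !RicE; have F0 := F_neq0 x.
by apply: vec4P; rewrite !mxE /=; field.
Qed.

Lemma semisymmetric_wave x : vanishes6 (dot g (Riem g) (Riem g)) x.
Proof.
move=> u1 u2 u3 u4 u v; rewrite /dot !sharp_RiemE !RiemE.
move: (Z u v) (W u v) => a b.
by rewrite /Z /W !vec4E; field.
Qed.

(** [P] is built from [R], [g] and [Ric], each annihilated by the derivation
    [R(u, v)]: [R] by semisymmetry, [g] by skew-symmetry, and [Ric] because
    [R(u, v)] takes its values in the kernel of [dx^1]. *)
Lemma dot_Riem_Proj x : vanishes6 (dot g (Riem g) (Proj g)) x.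
Proof.
move=> u1 u2 u3 u4 u v; rewrite /dot !ProjE !RiemE !innerE !RicE !sharp_RiemE.
move: (Z u v) (W u v) => a b.
by rewrite /Z /W !vec4E; field.
Qed.

(** By [sharp_ProjE] the derivation of [P] is the one of [R], which annihilates
    [P], minus a third of the one of [Ric]. *)
Lemma dot_Proj_Proj x u1 u2 u3 u4 u v :
  dot g (Proj g) (Proj g) x u1 u2 u3 u4 u v =
  - 3^-1 * Q (Ric g) (Proj g) x u1 u2 u3 u4 u v.
Proof.
apply/eqP; rewrite -subr_eq0 -[X in _ == X](dot_Riem_Proj x u1 u2 u3 u4 u v).
apply/eqP; rewrite /dot /Q !sharp_ProjE.
(* Only linearity in each slot is needed now, whatever the two operators. *)
move: (sharp g (Riem g) x u v) (wedge (Ric g) x u v) => r s.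
rewrite !ProjE !RiemE !innerE !RicE /Z /W !mxE; by field.
Qed.

(** * The curvature conditions *)

Section Classes.
Variable M : set V.
Hypothesis M_open : open M.

Lemma E_rational_affine a b : E_rational M (fun x => a * E x + b).
Proof.
apply: (@E_rational_add _ (cst a * E) (cst b)); last exact: E_rational_cst.
by apply: E_rational_mul; [exact: E_rational_cst | exact: E_rational_E].
Qed.

Lemma E_rational_ratio a b c d : (forall x, M x -> c * E x + d != 0) ->
  E_rational M (fun x => (a * E x + b) / (c * E x + d)).
Proof.
move=> cd0; apply: (@E_rational_mul _ (fun x => a * E x + b)
  (fun x => (c * E x + d)^-1)).
  exact: E_rational_affine.
by apply: E_rational_inv => //; exact: E_rational_affine.
Qed.

Lemma one_form_E_rational (U : set V) f a :
  U `<=` M -> E_rational M f -> one_form U (scaled_form f a).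
Proof.
move=> sU rf i k; apply: is_Ck_sub sU _; apply: E_rational_smooth => //.
rewrite (_ : (fun x => _) = f * cst (a i 0)).
  by apply: E_rational_mul => //; exact: E_rational_cst.
by apply/funext => x; rewrite mxE.
Qed.

Lemma one_form0 (U : set V) : U `<=` M -> one_form U (fun=> 0).
Proof.
move=> sU i k; apply: is_Ck_sub sU _; apply: E_rational_smooth => //.
rewrite (_ : (fun=> _) = cst 0); last by apply/funext => x; rewrite mxE.
exact: E_rational_cst.
Qed.

Lemma ev0 x u : ev (fun=> 0) x u = 0.
Proof. by rewrite /ev mulmx0 mxE. Qed.

Lemma recurrent4_weakly_symmetric H :
  recurrent4 g M H -> weakly_symmetric_wrt g M H.
Proof.
move=> [A oA HA]; exists A, (fun=> 0), (fun=> 0), (fun=> 0), (fun=> 0).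
split; first by split=> //; apply: one_form0 => x [].
by move=> x Ux u u1 u2 u3 u4; rewrite HA // !ev0 !mul0r !addr0.
Qed.

Lemma Ricci_recurrent_weakly_symmetric :
  Ricci_recurrent g M -> weakly_Ricci_symmetric g M.
Proof.
move=> [A oA HA]; exists A, (fun=> 0), (fun=> 0).
split; first by split=> //; apply: one_form0 => x [].
by move=> x Ux u u1 u2; rewrite HA // !ev0 !mul0r !addr0.
Qed.

(** [nabla R] has no component along [W (x) W], whereas [R] has one.  The
    components 1414, 1314 and 1413, in the directions [e_3], [e_4] and [e_4],
    then force [A], [B'] and [D'] to vanish on [e_3], and the component 1313
    in the direction [e_3] reads [E/2 = (A + B' + D')(e_3) * E/2]. *)
Lemma wave_not_weakly_symmetric : M !=set0 -> ~ weakly_symmetric g M.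
Proof.
move=> [p Mp] [A [B [B' [D [D' [_ eqR]]]]]].
have Ep := E_gt0 p; have Fp := F_neq0 p.
have Up : [set x | M x /\ ~ vanishes4 (Riem g) x] p.
  split=> // /(_ 'e_0 'e_2 'e_0 'e_2).
  rewrite RiemE /Z /W !mxE /=; lra.
have := eqR p Up 'e_2 'e_0 'e_2 'e_0 'e_2.
have := eqR p Up 'e_2 'e_0 'e_3 'e_0 'e_3.
have := eqR p Up 'e_3 'e_0 'e_2 'e_0 'e_3.
have := eqR p Up 'e_3 'e_0 'e_3 'e_0 'e_2.
rewrite !D4_RiemE !RiemE /Z /W !mxE /=.
have cancelF a : 0 = F p * a / 4 -> a = 0 by move=> eqa; apply: (mulfI Fp); lra.
move=> eqD' eqB' eqA eq2.
have D'0 : ev D' p 'e_2 = 0 by apply: cancelF; lra.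
have B'0 : ev B' p 'e_2 = 0 by apply: cancelF; lra.
have A0 : ev A p 'e_2 = 0 by apply: cancelF; lra.
by move: eq2; rewrite D'0 B'0 A0; lra.
Qed.

Lemma E_pos_affine_neq0 x : 2 * E x + 1 != 0.
Proof. by have := E_gt0 x; apply: contraTneq; lra. Qed.

(** The form is [d ln (E/2 + 1/4)], the logarithmic derivative of the
    coefficient of [Ric]. *)
Lemma wave_Ricci_recurrent : Ricci_recurrent g M.
Proof.
exists (scaled_form (fun x => (2 * E x + 0) / (2 * E x + 1)) dlogE).
  apply: one_form_E_rational => // [x []//|].
  by apply: E_rational_ratio => x _; exact: E_pos_affine_neq0.
move=> x _ u u1 u2; rewrite ev_dlogE D2_RicE RicE /Ricci_coef.
by field; exact: E_pos_affine_neq0.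
Qed.

Hypothesis M_pos : forall x, M x -> forall i, 0 < x 0 i.

Lemma E_gt1 x : (forall i, 0 < x 0 i) -> 1 < E x.
Proof. by move=> x0; rewrite expR_gt1 addr_gt0. Qed.

Lemma E_neq_half x : M x -> 2 * E x + -1 != 0.
Proof. by move=> /M_pos/E_gt1 ?; apply/negP => /eqP; lra. Qed.

(** The form is [d ln (2 E - 1)], the logarithmic derivative of the coefficient
    of [C]; it has no pole on [M], where the coordinates are positive and hence
    [E > 1]. *)
Lemma wave_conformally_recurrent : conformally_recurrent g M.
Proof.
exists (scaled_form (fun x => (2 * E x + 0) / (2 * E x + -1)) dlogE).
  apply: one_form_E_rational => // [x []//|].
  by apply: E_rational_ratio => x; exact: E_neq_half.
move=> x [Mx _] u u1 u2 u3 u4; rewrite ev_dlogE D4_ConfE ConfE.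
by field; exact: E_neq_half.
Qed.

Lemma wave_hyper_generalized_recurrent : hyper_generalized_recurrent g M.
Proof.
(* Comparing the coefficients of Z (x) Z and W (x) W, with A = a dlogE and
   B = b dlogE: a E / 2 + b (2 E + 1) / 4 = E / 2 and
   a / 4 + b (2 E + 1) / 4 = 0. *)
pose a x := (2 * E x + 0) / (2 * E x + -1).
pose b x := a x * ((0 * E x + -1) / (2 * E x + 1)).
have ra : E_rational M a by apply: E_rational_ratio => x; exact: E_neq_half.
have rb : E_rational M b.
  apply: E_rational_mul ra _.
  by apply: E_rational_ratio => x _; exact: E_pos_affine_neq0.
exists (scaled_form a dlogE), (scaled_form b dlogE).
split; first by split; apply: one_form_E_rational => // x [].
move=> x [Mx _ _] u u1 u2 u3 u4; rewrite !ev_dlogE D4_RiemE RiemE.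
rewrite KNC KN_RicE /b /a /Ricci_coef; field.
by rewrite E_pos_affine_neq0 E_neq_half.
Qed.

Lemma wave_not_class_A : M !=set0 -> ~ class_A g M.
Proof.
move=> [p Mp] /(_ p Mp 'e_2 'e_0 'e_0); rewrite !D2_RicE !mxE /=.
have := E_gt0 p; lra.
Qed.

Lemma wave_not_class_B : M !=set0 -> ~ class_B g M.
Proof.
move=> [p Mp] /(_ p Mp 'e_2 'e_0 'e_0); rewrite !D2_RicE !mxE /=.
have := E_gt0 p; lra.
Qed.

Lemma wave_not_Einstein : M !=set0 -> ~ Einstein g M.
Proof.
move=> [p Mp] /(_ p Mp 'e_0 'e_0); rewrite scalE RicE !mxE /=.
have := Ricci_coef_gt0 p; lra.
Qed.

Lemma wave_Ricci_simple : Ricci_simple g M.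
Proof.
exists (fun x => - 2^-1 * E x + - 4^-1), (scaled_form (cst 1) (delta_mx 0 0)).
split.
- by apply: E_rational_smooth => //; exact: E_rational_affine.
- by apply: one_form_E_rational => //; exact: E_rational_cst.
- by move=> x _ u v; rewrite RicE !ev_dx0 /Ricci_coef /cst; field.
Qed.

(** By the second Bianchi identity the left-hand side is zero; the form [dx^1]
    makes the right-hand side vanish, because it divides both [Z] and [W]. *)
Lemma wave_recurrent_curvature_2forms : recurrent_curvature_2forms g M.
Proof.
exists (scaled_form (cst 1) (delta_mx 0 0)).
  by apply: one_form_E_rational => //; exact: E_rational_cst.
move=> x _ u1 u2 u3 u v; rewrite !D4_RiemE !RiemE !ev_dx0 /cst /Z /W; by field.
Qed.

(** For the pair [(e_3, e_1)] the endomorphism of [S] sends every vector to a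
    multiple of [e_3], so only the terms [P(e_1, e_3, e_3, e_1)] and
    [P(e_1, e_3, e_1, e_3)] remain; their [R]-parts cancel. *)
Lemma wave_not_Proj_semisymmetric :
  M !=set0 -> ~ dot_zero g M (Proj g) (Proj g).
Proof.
move=> [p Mp] /(_ p Mp 'e_0 'e_2 'e_0 'e_0 'e_2 'e_0); rewrite dot_Proj_Proj.
have -> : Q (Ric g) (Proj g) p 'e_0 'e_2 'e_0 'e_0 'e_2 'e_0 =
    - (Ricci_coef p ^+ 2 / 3).
  have wedgeE w : wedge (Ric g) p 'e_2 'e_0 w =
      (- Ricci_coef p * w 0 0) *: 'e_2.
    by rewrite /wedge !RicE; apply: vec4P; rewrite !mxE /=; ring.
  rewrite /Q !wedgeE !ProjE !RiemE !innerE !RicE /Z /W !mxE /=.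
  by field.
by have := exprn_gt0 2 (Ricci_coef_gt0 p); lra.
Qed.

Lemma wave_Proj_proportional :
  dot_proportional g M (Proj g) (Proj g) (Ric g).
Proof.
exists (cst (- 3^-1)); last by move=> x _ *; exact: dot_Proj_Proj.
by apply: E_rational_smooth => //; exact: E_rational_cst.
Qed.

End Classes.
End WaveMetric.

Unset Implicit Arguments.

Theorem theorem3p1 (R : realType) (M : set 'rV[R]_4) (M_nonempty : M !=set0)
    (M_open : open M) (M_connected : connected M)
    (M_pos : forall x : 'rV[R]_4, M x -> forall i : 'I_4, 0 < x 0 i) :
  (~ locally_symmetric (metric R) M /\ semisymmetric (metric R) M)
  /\ (~ weakly_symmetric (metric R) M /\ weakly_Ricci_symmetric (metric R) M
      /\ conformally_weakly_symmetric (metric R) M)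
  /\ (~ recurrent (metric R) M /\ Ricci_recurrent (metric R) M
      /\ conformally_recurrent (metric R) M)
  /\ (~ recurrent (metric R) M /\ hyper_generalized_recurrent (metric R) M)
  /\ ((~ class_A (metric R) M /\ ~ class_B (metric R) M)
      /\ constant_scalar_curvature (metric R) M)
  /\ (~ Einstein (metric R) M /\ Ricci_simple (metric R) M)
  /\ (~ recurrent (metric R) M /\ recurrent_curvature_2forms (metric R) M)
  /\ (~ dot_zero (metric R) M (Proj (metric R)) (Proj (metric R))
      /\ dot_proportional (metric R) M (Proj (metric R)) (Proj (metric R))
           (Ric (metric R))).
Proof.
have not_weak := wave_not_weakly_symmetric M_nonempty.
have not_rec : ~ recurrent (metric R) M.
  by move=> /(recurrent4_weakly_symmetric M_open)/not_weak.
have Ricci_rec := wave_Ricci_recurrent M_open.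
have Conf_rec := wave_conformally_recurrent M_open M_pos.
split; first split.
- (* Local symmetry is recurrence for the zero form. *)
  move=> sym; apply: not_rec; exists (fun=> 0).
    by apply: (one_form0 M_open) => x [].
  by move=> x [Mx _] u u1 u2 u3 u4; rewrite sym // ev0 mul0r.
- by move=> x _; exact: semisymmetric_wave.
split; first (split; [exact: not_weak | split]).
- exact: Ricci_recurrent_weakly_symmetric.
- exact: recurrent4_weakly_symmetric.
split; first by [].
split; first by split=> //; exact: wave_hyper_generalized_recurrent.
split; first (split; first split).
- exact: wave_not_class_A.
- exact: wave_not_class_B.
- by exists 0 => x _; exact: scalE.
split; first (split; [exact: wave_not_Einstein | exact: wave_Ricci_simple]).
split; first by split=> //; exact: wave_recurrent_curvature_2forms.
by split; [exact: wave_not_Proj_semisymmetric | exact: wave_Proj_proportional].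
Qed.
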